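(* Let $k$ be an algebraically closed field and let $\Delta$ be trinomial data over $k$. If $X=\mathrm{Spec}(k[\Delta])$ is smooth over $k$, then $X\cong_k\mathbb{A}^d_k$, where $d=\dim X$.
   Context: Trinomial data $\Delta$ over a field $k$ consist of: (i) an integer $n\ge 2$ and a partition $n=n_0+\cdots+n_r$ with $r\ge 1$ and all $n_i\ge 1$ ($0\le i\le r$); (ii) tuples $\beta_i=(\beta_{i1},\dots,\beta_{in_i})$ of positive integers, $0\le i\le r$, such that with $d_i=\gcd(\beta_{i1},\dots,\beta_{in_i})$ one has $\gcd(d_i,d_j)=1$ for $i\ne j$; (iii) distinct elements $\lambda_2,\dots,\lambda_r\in k^*$ (the empty sequence if $r=1$). The associated ring is $$k[\Delta]=k[t_{ij}\mid 0\le i\le r,\ 1\le j\le n_i]/(T_0^{\beta_0}+\lambda_iT_1^{\beta_1}+T_i^{\beta_i})_{2\le i\le r},$$ where the $t_{ij}$ are $n$ independent variables and $T_i^{\beta_i}=t_{i1}^{\beta_{i1}}\cdots t_{in_i}^{\beta_{in_i}}$. If $r=1$, $k[\Delta]$ is the polynomial ring in $n$ variables. *)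

(* Defs.v *)
From HB Require Import structures.
From mathcomp Require Import all_boot all_order all_algebra.
From mathcomp Require Import boolp.
From mathcomp.multinomials Require Import mpoly.

Set Implicit Arguments.
Unset Strict Implicit.
Unset Printing Implicit Defensive.

Import GRing.Theory.
Local Open Scope ring_scope.
Local Open Scope quotient_scope.

Section CommutativeAlgebra.
Variable k : fieldType.

Definition ideal_gen (R : comNzRingType) (m : nat) (g : 'I_m -> R) (x : R) : Prop :=
  exists c : 'I_m -> R, x = \sum_(i < m) c i * g i.

Definition is_prime_ideal (R : comNzRingType) (p : {pred R}) : Prop :=
  idealr_closed p /\ prime_idealr_closed p.

Definition prime_chain (R : comNzRingType) (d : nat) (p : nat -> {pred R}) : Prop :=
  (forall i, (i <= d)%N -> is_prime_ideal (p i)) /\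
  (forall i, (i < d)%N ->
     {subset p i <= p i.+1} /\ exists2 x, x \in p i.+1 & x \notin p i).

(* dim (Spec R) = d : irreducible closed subsets of Spec R correspond to prime
   ideals, so this is the supremum of the lengths of chains of primes. *)
Definition krull_dim (R : comNzRingType) (d : nat) : Prop :=
  (exists p, prime_chain (R := R) d p) /\
  ~ (exists p, prime_chain (R := R) d.+1 p).

Definition surjective (T U : Type) (f : T -> U) : Prop :=
  forall y, exists x, f x = y.

Definition finitely_presented (A : comAlgType k) : Prop :=
  exists (m : nat) (q : {lrmorphism {mpoly k[m]} -> A}),
    surjective q /\
    exists (l : nat) (g : 'I_l -> {mpoly k[m]}),
      forall x, q x = 0 <-> ideal_gen g x.

(* Infinitesimal lifting along every surjection of k-algebras whose kernel has
   square zero. Algebras here are nonzero, which loses nothing: if the target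
   of such a surjection is the zero ring then so is the source. *)
Definition formally_smooth (A : comAlgType k) : Prop :=
  forall (C B : comAlgType k) (pi : {lrmorphism C -> B}),
    surjective pi ->
    (forall x y, pi x = 0 -> pi y = 0 -> x * y = 0) ->
    forall f : {lrmorphism A -> B},
      exists g : {lrmorphism A -> C}, forall a, pi (g a) = f a.

(* Smoothness over k of the affine k-scheme Spec A, as in EGA IV, 17.3.1. *)
Definition smooth_over (A : comAlgType k) : Prop :=
  finitely_presented A /\ formally_smooth A.

(* Isomorphism of the affine k-schemes Spec A and Spec B: affine k-schemes are
   the opposite category of commutative k-algebras. *)
Definition Spec_iso (A B : comAlgType k) : Prop :=
  exists f : {lrmorphism B -> A}, bijective f.

(* Spec of this algebra is the affine space A^d over k. *)
Definition coord_affine_space (d : nat) : comAlgType k := {mpoly k[d]}.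

End CommutativeAlgebra.

(* The partition of n is the family of block sizes n_0, ..., n_r, so that
   n = \sum_i n_i; the condition n >= 2 follows from r >= 1 and n_i >= 1.
   The scalars lambda_2, ..., lambda_r are indexed from 0 : [td_lambda D i]
   is lambda_{i+2}, so there are none when r = 1. *)
Record trinomial_data (k : fieldType) := TrinomialData {
  td_r : nat;
  td_size : 'I_td_r.+1 -> nat;
  td_beta : forall i : 'I_td_r.+1, 'I_(td_size i) -> nat;
  td_lambda : 'I_td_r.-1 -> k;
  td_r_gt0 : (0 < td_r)%N;
  td_size_gt0 : forall i, (0 < td_size i)%N;
  td_beta_gt0 : forall i j, (0 < td_beta (i := i) j)%N;
  td_coprime : forall i i', i != i' ->
    coprime (\big[gcdn/0%N]_j td_beta (i := i) j)
            (\big[gcdn/0%N]_j td_beta (i := i') j);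
  td_lambda_neq0 : forall i, td_lambda i != 0;
  td_lambda_inj : injective td_lambda
}.

Section TrinomialRing.
Variables (k : fieldType) (D : trinomial_data k).

Definition td_n : nat := (\sum_i td_size (t := D) i)%N.

(* The variable t_ij; Rank numbers the pairs (i, j) by 0, ..., n - 1. *)
Definition td_var (i : 'I_(td_r D).+1) (j : 'I_(td_size i)) : {mpoly k[td_n]} :=
  'X_(tagnat.Rank i j).

Definition td_mon (i : 'I_(td_r D).+1) : {mpoly k[td_n]} :=
  \prod_(j < td_size i) td_var j ^+ td_beta j.

(* The index i : 'I_(r - 1) stands for i + 2 in {2, ..., r}. *)
Definition td_rel (i : 'I_(td_r D).-1) : {mpoly k[td_n]} :=
  td_mon (inord 0) + td_lambda i *: td_mon (inord 1) + td_mon (inord i.+2).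

Definition td_ideal : {pred {mpoly k[td_n]}} :=
  fun p => `[< ideal_gen td_rel p >].

Lemma td_mon_coef0 i : (td_mon i)@_0 = 0.
Proof.
rewrite /td_mon rmorph_prod /=.
have j0 : 'I_(td_size i) by exists 0%N; exact: td_size_gt0.
rewrite (bigD1 j0) //= rmorphXn /= mcoeffX mnm1_eq0 expr0n.
by rewrite eqn0Ngt td_beta_gt0 mul0r.
Qed.

Lemma td_rel_coef0 i : (td_rel i)@_0 = 0.
Proof. by rewrite /td_rel !mcoeffD mcoeffZ !td_mon_coef0 mulr0 !addr0. Qed.

Lemma td_ideal_closed : idealr_closed td_ideal.
Proof.
split.
- apply/asboolP; exists (fun=> 0); rewrite big1 // => i _.
  by rewrite mul0r.
- apply/asboolP => -[c /(congr1 (mcoeff 0))].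
  rewrite mcoeff1 eqxx raddf_sum /= big1 => [/eqP|i _]; first by rewrite oner_eq0.
  by rewrite rmorphM /= td_rel_coef0 mulr0.
- move=> a p q /asboolP[c ->] /asboolP[e ->]; apply/asboolP.
  exists (fun i => a * c i + e i).
  rewrite mulr_sumr -big_split /=; apply: eq_bigr => i _.
  by rewrite mulrDl mulrA.
Qed.

HB.instance Definition _ := isIdealr.Build {mpoly k[td_n]} td_ideal td_ideal_closed.

Definition trinomial_ring := {ideal_quot td_ideal}.

HB.instance Definition _ := GRing.ComNzRing.on trinomial_ring.

(* The k-algebra structure induced by k -> k[t_ij] -> k[Delta]. *)
Definition td_scale (a : k) (x : trinomial_ring) : trinomial_ring :=
  \pi_trinomial_ring a%:MP * x.

Lemma td_scaleA a b x : td_scale a (td_scale b x) = td_scale (a * b) x.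
Proof. by rewrite /td_scale mulrA -rmorphM -mpolyCM. Qed.

Lemma td_scale1 : left_id 1 td_scale.
Proof. by move=> x; rewrite /td_scale mpolyC1 rmorph1 mul1r. Qed.

Lemma td_scaleDr : right_distributive td_scale +%R.
Proof. by move=> a x y; rewrite /td_scale mulrDr. Qed.

Lemma td_scaleDl x : {morph td_scale^~ x : a b / a + b}.
Proof. by move=> a b; rewrite /td_scale mpolyCD rmorphD mulrDl. Qed.

HB.instance Definition _ := GRing.Zmodule_isLmodule.Build k trinomial_ring
  td_scaleA td_scale1 td_scaleDr td_scaleDl.

Lemma td_scaleAl (a : k) (x y : trinomial_ring) : a *: (x * y) = (a *: x) * y.
Proof. exact: mulrA. Qed.

HB.instance Definition _ :=
  GRing.Lmodule_isLalgebra.Build k trinomial_ring td_scaleAl.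
HB.instance Definition _ := GRing.Lalgebra_isComAlgebra.Build k trinomial_ring.

End TrinomialRing.

(* Main.v *)
Require Import Defs.
From HB Require Import structures.
From mathcomp Require Import all_boot all_order all_algebra.
From mathcomp Require Import boolp ring.
From mathcomp.multinomials Require Import mpoly.

Set Implicit Arguments.
Unset Strict Implicit.
Unset Printing Implicit Defensive.

Import GRing.Theory.
Local Open Scope ring_scope.
Local Open Scope quotient_scope.

(* Call a block i linear if the monomial T_i is a single variable, that is, if
   T_i has degree 1. Any two of the T_i determine the others linearly, so if all
   blocks but two are linear, their variables can be eliminated and k[Delta] is
   a polynomial ring in the variables of the two remaining blocks.
   If three blocks a, b, c are not linear, the origin is a singular point. Let
   N > 1 be the degree of T_c. Sending the variables of block c to s and the
   others to 0 defines a morphism k[Delta] -> k[s]/(s^N). A lifting to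
   k[s]/(s^(N+1)) would send T_a and T_b to 0 and T_c to s^N, which contradicts
   the linear relation between T_a, T_b and T_c.
   That k[x_1, ..., x_d] has no chain of d + 2 primes p_0 < ... < p_(d+1)
   follows, after Coquand and Lombardi, from the algebraic dependence of any
   d + 1 polynomials y_0, ..., y_d: take y_i in p_(i+1) but not in p_i, and
   factor a relation along its lexicographically least monomial. *)

(** * Algebra morphisms out of polynomial and trinomial rings *)

Section MpolyEval.
Variables (k : fieldType) (A : comAlgType k) (n : nat) (h : 'I_n -> A).

Definition mpoly_eval : {mpoly k[n]} -> A := mmap (in_alg A) h.

HB.instance Definition _ := GRing.RMorphism.copy mpoly_eval (mmap (in_alg A) h).

Lemma mpoly_eval_is_scalable : scalable mpoly_eval.
Proof. by move=> c p; rewrite /mpoly_eval mmapZ /= mulr_algl. Qed.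

HB.instance Definition _ :=
  GRing.isScalable.Build k {mpoly k[n]} A *:%R mpoly_eval mpoly_eval_is_scalable.

Lemma mpoly_evalX i : mpoly_eval 'X_i = h i.
Proof. by rewrite /mpoly_eval mmapX mmap1U. Qed.

End MpolyEval.

Lemma mpoly_lrmorph_ext (k : fieldType) (A : comAlgType k) n
    (f g : {lrmorphism {mpoly k[n]} -> A}) :
  (forall i, f 'X_i = g 'X_i) -> f =1 g.
Proof.
move=> fg p; rewrite [p]mpolyE !linear_sum; apply: eq_bigr => m _.
rewrite !linearZ; congr (_ *: _).
rewrite mpolyXE_id !rmorph_prod; apply: eq_bigr => i _.
by rewrite !rmorphXn /= fg.
Qed.

Section TrinomialQuotient.
Variables (k : fieldType) (D : trinomial_data k).
Local Notation P := {mpoly k[td_n D]}.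
Local Notation A := (trinomial_ring D).

Definition trin_pi : P -> A := fun p => \pi_A p.

Fact trin_pi_is_zmod_morphism : zmod_morphism trin_pi.
Proof. exact: (@pi_is_zmod_morphism _ _ _ {ideal_quot (@td_ideal k D)}). Qed.

Fact trin_pi_is_monoid_morphism : monoid_morphism trin_pi.
Proof. exact: (@pi_is_monoid_morphism _ _ _ {ideal_quot (@td_ideal k D)}). Qed.

Fact trin_pi_is_scalable : scalable trin_pi.
Proof. by move=> c p; rewrite /trin_pi -mul_mpolyC rmorphM. Qed.

HB.instance Definition _ :=
  GRing.isZmodMorphism.Build P A trin_pi trin_pi_is_zmod_morphism.
HB.instance Definition _ :=
  GRing.isMonoidMorphism.Build P A trin_pi trin_pi_is_monoid_morphism.
HB.instance Definition _ :=
  GRing.isScalable.Build k P A *:%R trin_pi trin_pi_is_scalable.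

Lemma trin_pi_surj x : exists p, trin_pi p = x.
Proof. by exists (repr x); exact: reprK. Qed.

Lemma trin_pi_rel i : trin_pi (td_rel i) = 0.
Proof.
rewrite -(rmorph0 trin_pi); apply/eqP.
rewrite /trin_pi -Quotient.idealrBE subr0; apply/asboolP.
exists (fun j => (j == i)%:R); rewrite (bigD1 i) //= eqxx mul1r big1 ?addr0 //.
by move=> j /negPf->; rewrite mul0r.
Qed.

Section Lift.
Variables (B : comAlgType k) (f : {lrmorphism P -> B}).
Hypothesis f_rel : forall i, f (td_rel i) = 0.

Definition trin_lift (x : A) : B := f (repr x).

Lemma trin_lift_pi p : trin_lift (trin_pi p) = f p.
Proof.
apply/eqP; rewrite -subr_eq0 -rmorphB.
have : repr (trin_pi p) - p \in @td_ideal k D.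
  by rewrite Quotient.idealrBE reprK.
move=> /asboolP[c ->]; rewrite rmorph_sum big1 // => i _.
by rewrite rmorphM /= f_rel mulr0.
Qed.

End Lift.

Lemma trin_lift_exists (B : comAlgType k) (f : {lrmorphism P -> B}) :
  (forall i, f (td_rel i) = 0) ->
  exists g : {lrmorphism A -> B}, forall p, g (trin_pi p) = f p.
Proof.
move=> f_rel.
have addf : zmod_morphism (trin_lift f).
  move=> x y; have [p <-] := trin_pi_surj x; have [q <-] := trin_pi_surj y.
  by rewrite -rmorphB !trin_lift_pi // rmorphB.
have mulf : monoid_morphism (trin_lift f).
  split; first by rewrite -(rmorph1 trin_pi) trin_lift_pi // rmorph1.
  move=> x y; have [p <-] := trin_pi_surj x; have [q <-] := trin_pi_surj y.
  by rewrite -rmorphM !trin_lift_pi // rmorphM.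
have scf : scalable (trin_lift f).
  move=> c x; have [p <-] := trin_pi_surj x.
  by rewrite -linearZ !trin_lift_pi // linearZ.
pose aM := GRing.isZmodMorphism.Build A B (trin_lift f) addf.
pose mM := GRing.isMonoidMorphism.Build A B (trin_lift f) mulf.
pose sM := GRing.isScalable.Build k A B *:%R (trin_lift f) scf.
pose g : {lrmorphism A -> B} := HB.pack (trin_lift f) aM mM sM.
by exists g => p; exact: trin_lift_pi.
Qed.

End TrinomialQuotient.

(** * Krull dimension of polynomial rings *)

Section PrimeIdeals.
Variables (R : comNzRingType) (p : {pred R}).
Hypothesis pP : is_prime_ideal p.

Lemma prime_ideal0 : 0 \in p. Proof. by case: pP => -[]. Qed.

Lemma prime_ideal1 : 1 \notin p. Proof. by case: pP => -[]. Qed.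

Lemma prime_idealD x y : x \in p -> y \in p -> x + y \in p.
Proof. by case: pP => -[_ _ h] _ px py; rewrite -[x]mul1r h. Qed.

Lemma prime_idealMl a x : x \in p -> a * x \in p.
Proof. by case: pP => -[p0 _ h] _ px; rewrite -[a * x]addr0 h. Qed.

Lemma prime_idealMI x y : x * y \in p -> x \notin p -> y \in p.
Proof. by case: pP => _ h /h/orP[->|]. Qed.

Lemma prime_idealXI x n y : x ^+ n * y \in p -> x \notin p -> y \in p.
Proof.
move=> + px; elim: n y => [|n IH] y; first by rewrite mul1r.
by rewrite exprSr -mulrA => /IH/prime_idealMI; apply.
Qed.

End PrimeIdeals.

Lemma prime_ideal_preim (R S : comNzRingType) (f : {rmorphism R -> S})
    (p : {pred S}) : is_prime_ideal p -> is_prime_ideal (fun x => f x \in p).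
Proof.
move=> pP; have [[p0 p1 pD] pM] := pP; split; first split.
- by rewrite unfold_in rmorph0.
- by rewrite unfold_in rmorph1.
- by move=> a x y; have := pD (f a) (f x) (f y); rewrite -rmorphM -rmorphD.
- by move=> x y; have := pM (f x) (f y); rewrite -rmorphM.
Qed.

Lemma prime_chain_preim (R S : comNzRingType) (f : {rmorphism R -> S}) d :
  bijective f -> (exists p, prime_chain (R := S) d p) ->
  exists p, prime_chain (R := R) d p.
Proof.
move=> [g fK gK] [p [pP plt]]; exists (fun i x => f x \in p i).
split=> [i /pP|i /plt[sub [x px px']]]; first exact: prime_ideal_preim.
split; first by move=> y; exact: (sub (f y)).
by exists (g x); rewrite unfold_in gK.
Qed.

Lemma krull_dim_iso (R S : comNzRingType) (f : {rmorphism R -> S}) d :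
  bijective f -> krull_dim R d -> krull_dim S d.
Proof.
move=> [g fK gK] [Rd Rd1].
have gB : zmod_morphism g by exact: can2_zmod_morphism fK gK.
have gM : monoid_morphism g by exact: can2_monoid_morphism fK gK.
pose aM := GRing.isZmodMorphism.Build S R g gB.
pose mM := GRing.isMonoidMorphism.Build S R g gM.
pose h : {rmorphism S -> R} := HB.pack g aM mM.
split; first by apply: (prime_chain_preim (f := h)) Rd; exists f.
by move=> Sd1; apply: Rd1; apply: (prime_chain_preim (f := f)) Sd1; exists g.
Qed.

Lemma chain_alg_indep (k : fieldType) (R : comAlgType k) d
    (p : nat -> {pred R}) (x : nat -> R) (I : finType) (c : I -> k)
    (e : I -> nat -> nat) :
  prime_chain d p ->
  (forall i, (i < d)%N -> x i \in p i.+1 /\ x i \notin p i) ->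
  (forall a b, (forall j, (j < d)%N -> e a j = e b j) -> a = b) ->
  \sum_a c a *: \prod_(0 <= j < d) x j ^+ e a j = 0 -> forall a, c a = 0.
Proof.
move=> [pP plt] xP e_inj sum0 a0; apply/eqP; apply: contraT => ca0.
(* Q selects the exponents whose first i entries are lexicographically least. *)
suff H i : (i <= d)%N -> exists Q : pred I,
    [/\ exists2 a, Q a & c a != 0,
        forall a b, Q a -> Q b -> forall j, (j < i)%N -> e a j = e b j
      & \sum_(a | Q a) c a *: \prod_(i <= j < d) x j ^+ e a j \in p i].
  have [Q [[a Qa ca] Qeq]] := H d (leqnn d).
  rewrite (bigD1 a) //= [X in _ + X]big1 ?addr0 => [|b /andP[Qb]]; last first.
    by move=> /eqP[]; apply: e_inj; apply: Qeq.
  rewrite big_geq // => /(prime_idealMl (pP d (leqnn d)) (c a)^-1%:A).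
  by rewrite mulr_algl scalerA mulVf // scale1r (negPf (prime_ideal1 (pP d _))).
elim: i => [|i IH] id.
  exists (fun=> true); split; [by exists a0|by []|].
  by rewrite sum0 (prime_ideal0 (pP 0%N _)).
have [Q [[a1 Qa1 ca1] Qeq]] := IH (ltnW id).
have [xi1 xi] := xP i id; have [pi1 pi] := (pP i.+1 id, pP i (ltnW id)).
have Q1a1 : Q a1 && (c a1 != 0) by rewrite Qa1.
case: (@arg_minnP _ a1 (fun a => Q a && (c a != 0)) (fun a => e a i) Q1a1).
move=> am /andP[Qam cam] am_min.
rewrite (bigID (fun a => c a != 0)) /= [X in _ + X]big1 ?addr0; last first.
  by move=> a /andP[_ /negPn/eqP->]; rewrite scale0r.
pose m := e am i.
pose G a := c a *: \prod_(i.+1 <= j < d) x j ^+ e a j.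
have -> : \sum_(a | Q a && (c a != 0)) c a *: \prod_(i <= j < d) x j ^+ e a j
    = x i ^+ m * (\sum_(a | Q a && (c a != 0) && (e a i == m)) G a
      + (\sum_(a | Q a && (c a != 0) && (e a i != m))
           x i ^+ (e a i - m).-1 * G a) * x i).
  rewrite (bigID (fun a => e a i == m)) /= mulrDr; congr (_ + _).
    rewrite mulr_sumr; apply: eq_bigr => a /andP[_ /eqP ea].
    by rewrite big_ltn // ea /G -!scalerAr.
  rewrite mulr_suml mulr_sumr; apply: eq_bigr => a /andP[Qca ea].
  have lt : (m < e a i)%N by rewrite ltn_neqAle eq_sym ea am_min.
  rewrite big_ltn // /G -!scalerAr -!scalerAl -scalerAr; congr (_ *: _).
  rewrite mulrAC -exprSr prednK ?subn_gt0 // mulrA -exprD subnKC //.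
  exact: ltnW.
move=> /(prime_idealXI pi)/(_ xi).
set u := \sum_(a | _) _; set v := \sum_(a | _) _ => puv.
exists (fun a => Q a && (c a != 0) && (e a i == m)); split.
- by exists am; rewrite ?Qam ?cam ?eqxx.
- move=> a b /andP[/andP[Qa _] /eqP ea] /andP[/andP[Qb _] /eqP eb] j.
  by rewrite ltnS leq_eqVlt => /orP[/eqP->|]; [rewrite ea eb|exact: Qeq].
- have -> : \sum_(a | Q a && (c a != 0) && (e a i == m))
      c a *: \prod_(i.+1 <= j < d) x j ^+ e a j = (u + v * x i) + (- v) * x i.
    by rewrite mulNr addrK.
  by apply: prime_idealD => //; [exact: (plt i id).1|exact: prime_idealMl].
Qed.

Section Degree.
Variables (k : fieldType) (n : nat).
Implicit Types p q : {mpoly k[n]}.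

Lemma msizeM_leS p q a b :
  (msize p <= a.+1)%N -> (msize q <= b.+1)%N -> (msize (p * q) <= (a + b).+1)%N.
Proof.
have [->|p0] := eqVneq p 0; first by rewrite mul0r mmeasure0.
have [->|q0] := eqVneq q 0; first by rewrite mulr0 mmeasure0.
rewrite msizeM // => pa qb; rewrite -ltnS.
have : (0 < msize p)%N by rewrite lt0n mmeasure_poly_eq0.
have := leq_add pa qb; rewrite addnS addSn.
by case: (msize p) => //= c; rewrite addSn ltnS.
Qed.

Lemma msizeX_leS p a e : (msize p <= a.+1)%N -> (msize (p ^+ e) <= (e * a).+1)%N.
Proof.
move=> pa; elim: e => [|e IH]; first by rewrite expr0 msize1.
by rewrite exprS mulSn msizeM_leS.
Qed.

Lemma msize_prod_leS (I : finType) (F : I -> {mpoly k[n]}) (a : I -> nat) :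
  (forall i, (msize (F i) <= (a i).+1)%N) ->
  (msize (\prod_i F i) <= (\sum_i a i).+1)%N.
Proof.
move=> Fa; elim/big_rec2: _ => [|i m p _ IH]; first by rewrite msize1.
exact: msizeM_leS.
Qed.

End Degree.

(* The N^(d+1) products of powers < N of the x_i lie in a space of dimension
   O(N^d), so they are linearly dependent when N is large. *)
Lemma mpoly_alg_dependent (k : fieldType) d (x : 'I_d.+1 -> {mpoly k[d]}) :
  exists N (c : {ffun 'I_d.+1 -> 'I_N} -> k),
    (exists f, c f != 0) /\ \sum_f c f *: \prod_i x i ^+ f i = 0.
Proof.
pose a := (\sum_i msize (x i))%N.
have xa i : (msize (x i) <= a.+1)%N.
  by rewrite leqW // /a (bigD1 i) //= leq_addr.
pose E := (d.+1 * a).+1; pose N := (E ^ d).+1; pose B := (d.+1 * (N * a)).+1.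
pose I := {ffun 'I_d.+1 -> 'I_N}; pose J := {ffun 'I_d -> 'I_B}.
pose mon (f : I) := \prod_i x i ^+ f i.
have mon_size f : (msize (mon f) <= B)%N.
  apply: (leq_trans (msize_prod_leS (fun i => msizeX_leS (f i) (xa i)))).
  rewrite ltnS -[X in (_ <= X * _)%N]card_ord -sum_nat_const.
  apply: leq_sum => i _.
  by rewrite leq_mul2r ltnW ?orbT.
pose mJ (g : J) : 'X_{1..d} := [multinom (g i : nat) | i < d].
have cardIJ : (#|J| < #|I|)%N.
  rewrite !card_ffun !card_ord.
  apply: (@leq_ltn_trans ((N * E) ^ d)).
    elim: (d) => // e IHe; rewrite !expnS leq_mul //.
    by rewrite /B /E mulnS mulnCA addSn ltnS leq_addl.
  by rewrite expnMn expnS mulnC ltn_pmul2r ?expn_gt0 // /N.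
pose M := \matrix_(u < #|I|, v < #|J|) (mon (enum_val u))@_(mJ (enum_val v)).
have kerM : kermx M != 0.
  rewrite -mxrank_eq0 mxrank_ker subn_eq0 -ltnNge.
  exact: leq_ltn_trans (rank_leq_col M) cardIJ.
pose v := nz_row (kermx M).
have vM : v *m M = 0 by apply/sub_kermxP; exact: nz_row_sub.
have v0 : v != 0 by rewrite nz_row_eq0.
exists N, (fun f => v 0 (enum_rank f)); split.
  have /rV0Pn[u vu] := v0.
  by exists (enum_val u); rewrite enum_valK.
apply/mpolyP => m; rewrite mcoeff0 linear_sum /=.
have [mB|mB] := leqP B (mdeg m).
  rewrite big1 // => f _; rewrite mcoeffZ memN_msupp_eq0 ?mulr0 //.
  by apply: msize_mdeg_ge; apply: leq_trans (mon_size f) mB.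
have mi i : (m i < B)%N.
  by apply: leq_ltn_trans mB; rewrite mdegE (bigD1 i) //= leq_addr.
pose g : J := [ffun i => Ordinal (mi i)].
have mg : mJ g = m by apply/mnmP => i; rewrite mnmE ffunE.
have /matrixP/(_ 0 (enum_rank g)) := vM; rewrite mxE [RHS]mxE => E0.
rewrite -[RHS]E0 (reindex (@enum_val I predT)) /=; last first.
  by apply: onW_bij; exact: enum_val_bij.
by apply: eq_bigr => u _; rewrite mcoeffZ [M _ _]mxE enum_rankK mg enum_valK.
Qed.

Section MpolyDim.
Variables (k : fieldType) (d : nat).
Local Notation P := {mpoly k[d]}.

Let kill i : {lrmorphism P -> P} :=
  mpoly_eval (fun j : 'I_d => if (j < i)%N then 0 else 'X_j).

Let kill_le i j : (i <= j)%N -> kill j \o kill i =1 kill j.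
Proof.
move=> ij; apply: mpoly_lrmorph_ext => u.
rewrite /= /kill !mpoly_evalX; case: ifP => ui; last by rewrite mpoly_evalX.
by rewrite rmorph0 (leq_trans ui ij).
Qed.

Lemma mpoly_prime_chain : exists p, prime_chain (R := P) d p.
Proof.
exists (fun i q => kill i q == 0); split=> [i _|i id].
  split; first split.
  - by rewrite unfold_in rmorph0.
  - by rewrite unfold_in rmorph1 oner_eq0.
  - move=> a x y; rewrite !unfold_in => /eqP x0 /eqP y0.
    by rewrite rmorphD rmorphM /= x0 y0 mulr0 addr0.
  - by move=> x y; rewrite !unfold_in rmorphM mulf_eq0.
split=> [q|].
  by rewrite !unfold_in => /eqP q0; rewrite -(kill_le (leqnSn i)) /= q0 rmorph0.
exists 'X_(Ordinal id); rewrite unfold_in /= mpoly_evalX /=.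
  by rewrite ltnSn.
by rewrite ltnn -msupp_eq0 msuppX.
Qed.

Lemma krull_dim_mpoly : krull_dim P d.
Proof.
split; first exact: mpoly_prime_chain.
move=> [p pC]; have [pP plt] := pC.
have /fin_all_exists[x xP] (i : 'I_d.+1) :
    exists y : P, y \in p i.+1 /\ y \notin p i.
  by have [_ [y]] := plt i (ltn_ord i); exists y.
have [N [c [[f cf] sum0]]] := mpoly_alg_dependent x.
move/eqP: cf; apply.
apply: (@chain_alg_indep k P d.+1 p (fun i => x (inord i)) _ c
  (fun f i => f (inord i)) pC).
- by move=> i id; have := xP (inord i); rewrite inordK.
- move=> g h gh; apply/ffunP => i; apply: val_inj.
  by have := gh i (ltn_ord i); rewrite inord_val.
- rewrite -[RHS]sum0; apply: eq_bigr => g _; rewrite big_mkord.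
  by congr (_ *: _); apply: eq_bigr => i _; rewrite inord_val.
Qed.

End MpolyDim.

(** * The linear relations between the monomials *)

Section TrinomialVectors.
Variables (k : fieldType) (D : trinomial_data k).
Local Notation r := (td_r D).
Local Notation block := 'I_r.+1.

(* The relations say that each monomial T_i is the combination of T_0 and T_1
   with coefficients [td_vec i]; these vectors are pairwise independent. *)
Definition td_vec (i : block) : k * k :=
  match val i with
  | 0%N => (1, 0)
  | 1%N => (0, 1)
  | m.+2 => (-1, if insub m is Some u then - td_lambda (t := D) u else 0)
  end.

Definition td_det (i j : block) : k :=
  (td_vec i).1 * (td_vec j).2 - (td_vec i).2 * (td_vec j).1.

Lemma td_relI_lt (u : 'I_r.-1) : (u.+2 < r.+1)%N.
Proof. by rewrite ltnS -[X in (_ < X)%N](ltn_predK (td_r_gt0 D)) ltnS. Qed.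

Lemma td_vec0 : td_vec (inord 0) = (1, 0).
Proof. by rewrite /td_vec /= inordK. Qed.

Lemma td_vec1 : td_vec (inord 1) = (0, 1).
Proof. by rewrite /td_vec /= inordK // ltnS td_r_gt0. Qed.

Lemma td_vecS (u : 'I_r.-1) : td_vec (inord u.+2) = (-1, - td_lambda u).
Proof. by rewrite /td_vec /= inordK ?td_relI_lt // valK. Qed.

Lemma td_blockP (i : block) :
  [\/ i = inord 0, i = inord 1 | exists u : 'I_r.-1, i = inord u.+2].
Proof.
case: i => -[|[|m]] mr; [constructor 1|constructor 2|constructor 3].
- by apply: val_inj; rewrite /= inordK.
- by apply: val_inj; rewrite /= inordK.
have mr' : (m < r.-1)%N by move: mr; case: r.
by exists (Ordinal mr'); apply: val_inj; rewrite /= inordK.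
Qed.

Lemma td_det_neq0 i j : i != j -> td_det i j != 0.
Proof.
rewrite /td_det; case: (td_blockP i) => [->|->|[u ->]];
  case: (td_blockP j) => [->|->|[w ->]];
  rewrite ?eqxx // ?td_vec0 ?td_vec1 ?td_vecS /= => ij;
  rewrite ?(mul1r, mul0r, mulr0, mulr1, subr0, sub0r, oppr_eq0, oner_eq0,
            td_lambda_neq0) //.
have -> : -1 * - td_lambda w - - td_lambda u * -1 = td_lambda w - td_lambda u.
  by ring.
rewrite subr_eq0 eq_sym.
by apply: contraNneq ij => /td_lambda_inj->.
Qed.

Lemma td_comb_rel (V : lmodType k) (U W : V) (y : block -> V) :
  (forall i, y i = (td_vec i).1 *: U + (td_vec i).2 *: W) ->
  forall u : 'I_r.-1,
      y (inord 0) + td_lambda u *: y (inord 1) + y (inord u.+2) = 0.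
Proof.
move=> yE u; rewrite !yE td_vec0 td_vec1 td_vecS /=.
rewrite !(scale1r, scale0r, addr0, add0r, scaleN1r, scaleNr).
by rewrite -opprD subrr.
Qed.

Lemma td_rel_comb (V : lmodType k) (y : block -> V) :
  (forall u : 'I_r.-1,
      y (inord 0) + td_lambda u *: y (inord 1) + y (inord u.+2) = 0) ->
  forall i, y i = (td_vec i).1 *: y (inord 0) + (td_vec i).2 *: y (inord 1).
Proof.
move=> yr i; case: (td_blockP i) => [->|->|[u ->]].
- by rewrite td_vec0 /= scale1r scale0r addr0.
- by rewrite td_vec1 /= scale1r scale0r add0r.
rewrite td_vecS /= scaleN1r scaleNr -opprD; apply/eqP.
by rewrite -addr_eq0 addrC yr.
Qed.

Lemma td_cramer (V : lmodType k) (y : block -> V) a b c :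
  (forall u : 'I_r.-1,
      y (inord 0) + td_lambda u *: y (inord 1) + y (inord u.+2) = 0) ->
  td_det a b *: y c = td_det c b *: y a + td_det a c *: y b.
Proof.
move=> /td_rel_comb yE; rewrite (yE a) (yE b) (yE c) /td_det.
rewrite !scalerDr !scalerA addrACA -!scalerDl.
by congr (_ *: _ + _ *: _); ring.
Qed.

Lemma td_comb_of_pair (V : lmodType k) (U W : V) a b : a != b ->
  exists y : block -> V,
    [/\ y a = U, y b = W
      & forall u : 'I_r.-1,
          y (inord 0) + td_lambda u *: y (inord 1) + y (inord u.+2) = 0].
Proof.
move=> /td_det_neq0 ab; pose d := (td_det a b)^-1.
pose y c := (td_det c b * d) *: U + (td_det a c * d) *: W.
exists y; split; rewrite ?/y.
- have -> : td_det a a = 0 by rewrite /td_det; ring.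
  by rewrite mulfV // mul0r scale1r scale0r addr0.
- have -> : td_det b b = 0 by rewrite /td_det; ring.
  by rewrite mulfV // mul0r scale1r scale0r add0r.
apply: (@td_comb_rel V
  (((td_vec b).2 * d) *: U - ((td_vec a).2 * d) *: W)
  (((td_vec a).1 * d) *: W - ((td_vec b).1 * d) *: U) y) => i.
rewrite /y /td_det.
rewrite !scalerBr !scalerA [X in _ = _ + X]addrC [RHS]addrACA -!scaleNr.
rewrite -!scalerDl.
by congr (_ *: _ + _ *: _); ring.
Qed.

Lemma rmorph_td_rel (V : comAlgType k) (f : {lrmorphism {mpoly k[td_n D]} -> V}) u :
  f (td_rel u) = f (td_mon (inord 0)) + td_lambda u *: f (td_mon (inord 1))
    + f (td_mon (inord u.+2)).
Proof. by rewrite /td_rel !rmorphD /= linearZ. Qed.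

Lemma rmorph_td_mon (V : comAlgType k) (f : {lrmorphism {mpoly k[td_n D]} -> V})
    (i : block) :
  f (td_mon i) = \prod_j f (td_var j) ^+ td_beta (i := i) j.
Proof. by rewrite rmorph_prod; apply: eq_bigr => j _; rewrite rmorphXn. Qed.

End TrinomialVectors.

(** * Smoothness *)

Lemma in_qpolyK (R : nzRingType) (h : {poly R}) (x : {poly %/ h}) :
  in_qpoly h (val x) = x.
Proof. by apply: val_inj; exact: in_qpoly_small (size_mk_monic x). Qed.

Lemma in_qpolyXn_eq0 (k : fieldType) N (p : {poly k}) : (0 < N)%N ->
  reflect (exists q, p = 'X^N * q) (in_qpoly 'X^N p == 0).
Proof.
move=> N0; rewrite -val_eqE /= mk_monic_Xn prednK //.
rewrite -Pdiv.IdomainMonic.modpE ?monicXn //.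
apply: (iffP (dvdpP _ _)) => -[q ->]; exists q; exact: mulrC.
Qed.

(* C = k[s]/(s^(N+1)) and B = k[s]/(s^N). *)
Lemma truncated_extension (k : fieldType) N : (0 < N)%N ->
  exists (C B : comAlgType k) (pi : {lrmorphism C -> B}) (s : C),
    [/\ Defs.surjective pi, s ^+ N != 0, s ^+ N.+1 = 0, pi (s ^+ N) = 0
      & forall y, pi y = 0 -> exists u, y = s ^+ N * u].
Proof.
move=> N0.
pose C : comAlgType k := {poly %/ ('X^(N.+1) : {poly k})}.
pose B : comAlgType k := {poly %/ ('X^N : {poly k})}.
pose toC : {lrmorphism {poly k} -> C} := in_qpoly 'X^(N.+1).
pose toB : {lrmorphism {poly k} -> B} := in_qpoly 'X^N.
have toC_surj (x : C) : exists p, toC p = x.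
  by exists (val x); exact: in_qpolyK.
pose f (x : C) : B := toB (val x).
have f_toC p : f (toC p) = toB p.
  apply/eqP; rewrite -subr_eq0 -rmorphB; apply/in_qpolyXn_eq0 => //.
  have /in_qpolyXn_eq0[//|q Eq] : toC (val (toC p) - p) == 0.
    by rewrite rmorphB subr_eq0; apply/eqP; exact: in_qpolyK.
  by exists ('X * q); rewrite Eq mulrA -exprSr.
have fB : zmod_morphism f.
  move=> x y; have [p <-] := toC_surj x; have [q <-] := toC_surj y.
  by rewrite -rmorphB !f_toC rmorphB.
have fM : monoid_morphism f.
  split; first by rewrite -(rmorph1 toC) f_toC rmorph1.
  move=> x y; have [p <-] := toC_surj x; have [q <-] := toC_surj y.
  by rewrite -rmorphM !f_toC rmorphM.
have fZ : scalable f.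
  by move=> c x; have [p <-] := toC_surj x; rewrite -linearZ !f_toC linearZ.
pose aM := GRing.isZmodMorphism.Build C B f fB.
pose mM := GRing.isMonoidMorphism.Build C B f fM.
pose sM := GRing.isScalable.Build k C B *:%R f fZ.
pose pi : {lrmorphism C -> B} := HB.pack f aM mM sM.
have pi_toC p : pi (toC p) = toB p by exact: f_toC.
exists C, B, pi, (toC 'X); split.
- move=> y; exists (toC (val y)); rewrite pi_toC; exact: in_qpolyK.
- rewrite -rmorphXn; apply/in_qpolyXn_eq0 => // -[q].
  move/(congr1 (fun p : {poly k} => p`_N)).
  by rewrite coefXn eqxx coefXnM ltnSn => /eqP; rewrite oner_eq0.
- by rewrite -rmorphXn; apply/eqP/in_qpolyXn_eq0 => //; exists 1; rewrite mulr1.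
- rewrite -rmorphXn pi_toC; apply/eqP/in_qpolyXn_eq0 => //.
  by exists 1; rewrite mulr1.
move=> y; have [p <-] := toC_surj y.
rewrite pi_toC => /eqP/in_qpolyXn_eq0[//|q ->].
by exists (toC q); rewrite -rmorphXn -rmorphM.
Qed.

Section Smooth.
Variables (k : fieldType) (D : trinomial_data k).
Local Notation block := 'I_(td_r D).+1.

Definition td_deg (i : block) : nat := (\sum_j td_beta (i := i) j)%N.

Lemma td_deg_gt0 i : (0 < td_deg i)%N.
Proof.
rewrite /td_deg (bigD1 (Ordinal (td_size_gt0 i))) //=.
by rewrite ltn_addr // td_beta_gt0.
Qed.

Lemma smooth_three_nonlinear_blocksF (a b c : block) :
  formally_smooth (trinomial_ring D) -> a != b -> a != c -> b != c ->
  (1 < td_deg a)%N -> (1 < td_deg b)%N -> (1 < td_deg c)%N -> False.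
Proof.
move=> smooth ab ac bc da db dc; set N := td_deg c in dc.
have N0 : (0 < N)%N := ltnW dc.
have [C [B [pi [s [pi_surj sN0 sN1 pi_sN kerpi]]]]] := truncated_extension k N0.
pose f0 : {lrmorphism {mpoly k[td_n D]} -> B} :=
  mpoly_eval (fun x => if tagnat.sig1 x == c then pi s else 0).
have f0_var i j : f0 (td_var (i := i) j) = if i == c then pi s else 0.
  by rewrite /f0 /td_var /= mpoly_evalX tagnat.Rank1K.
have f0_mon i : f0 (td_mon i) = 0.
  rewrite rmorph_td_mon.
  under eq_bigr do rewrite f0_var.
  rewrite prodrXr -/(td_deg i); case: eqP => [->|_]; first by rewrite -rmorphXn.
  by rewrite expr0n eqn0Ngt td_deg_gt0.
have [f fE] : exists f : {lrmorphism trinomial_ring D -> B},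
    forall p, f (trin_pi p) = f0 p.
  by apply: trin_lift_exists => u; rewrite rmorph_td_rel !f0_mon scaler0 !addr0.
have sX0 m : (N < m)%N -> s ^+ m = 0.
  by move=> Nm; rewrite -(subnKC Nm) exprD sN1 mul0r.
have sq0 x y : pi x = 0 -> pi y = 0 -> x * y = 0.
  move=> /kerpi[u ->] /kerpi[v ->]; rewrite mulrACA -exprD sX0 ?mul0r //.
  by rewrite -[X in (X < _)%N]addn0 ltn_add2l.
have [g gE] := smooth C B pi pi_surj sq0 f.
pose h : {lrmorphism {mpoly k[td_n D]} -> C} := g \o @trin_pi k D.
have h_rel u : h (td_rel u) = 0 by rewrite /h /= trin_pi_rel rmorph0.
have pi_h p : pi (h p) = f0 p by rewrite /h /= gE fE.
have h_mon0 i : i != c -> (1 < td_deg i)%N -> h (td_mon i) = 0.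
  move=> ic di.
  have /fin_all_exists[u uE] (j : 'I_(td_size i)) :
      exists u : C, h (td_var j) = s ^+ N * u.
    by apply: kerpi; rewrite pi_h f0_var (negPf ic).
  rewrite rmorph_td_mon.
  under eq_bigr do rewrite uE exprMn.
  rewrite big_split /= prodrXr -/(td_deg i) -exprM.
  by rewrite sX0 ?mul0r // -[X in (X < _)%N]muln1 ltn_pmul2l.
have h_monc : h (td_mon c) = s ^+ N.
  have /fin_all_exists[u uE] (j : 'I_(td_size c)) :
      exists u : C, h (td_var j) = s * (1 + s ^+ N.-1 * u).
    have [|u] := kerpi (h (td_var j) - s).
      by rewrite rmorphB /= [pi (h _)]pi_h f0_var eqxx subrr.
    move=> /eqP; rewrite subr_eq => /eqP->; exists u.
    by rewrite mulrDr mulr1 mulrA -exprS prednK // addrC.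
  rewrite rmorph_td_mon.
  under eq_bigr do rewrite uE exprMn.
  rewrite big_split /= prodrXr -/(td_deg c) -/N.
  have absorb w e : s ^+ N * (1 + s ^+ N.-1 * w) ^+ e = s ^+ N.
    elim: e => [|e IH]; first by rewrite mulr1.
    rewrite exprSr mulrA IH mulrDr mulr1 mulrA -exprD.
    rewrite (sX0 (N + N.-1)%N) ?mul0r ?addr0 //.
    by rewrite -[X in (X < _)%N]addn0 ltn_add2l -ltnS prednK.
  by elim/big_rec: _ => [|j x _ IH]; rewrite ?mulr1 // mulrA absorb.
have h_comb (u : 'I_(td_r D).-1) : h (td_mon (inord 0))
    + td_lambda u *: h (td_mon (inord 1)) + h (td_mon (inord u.+2)) = 0.
  by rewrite -rmorph_td_rel h_rel.
have := td_cramer (y := fun i => h (td_mon i)) a b c h_comb.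
rewrite (h_mon0 a) // (h_mon0 b) // h_monc !scaler0 addr0 => /eqP.
by rewrite scaler_eq0 (negPf sN0) (negPf (td_det_neq0 ab)).
Qed.

End Smooth.

(** * Elimination of the linear blocks *)

Section Elimination.
Variables (k : fieldType) (D : trinomial_data k).
Local Notation block := 'I_(td_r D).+1.

Lemma smooth_two_blocks : formally_smooth (trinomial_ring D) ->
  exists a b : block,
    a != b /\ forall i, i != a -> i != b -> td_deg i = 1%N.
Proof.
move=> smooth; pose NL (i : block) := (1 < td_deg i)%N.
have linear i : ~~ NL i -> td_deg i = 1%N.
  by rewrite -leqNgt => di; apply/eqP; rewrite eqn_leq di td_deg_gt0.
have neq (a : block) : exists b : block, a != b.
  have lt1 : (1 < (td_r D).+1)%N by rewrite ltnS td_r_gt0.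
  have [->|a0] := eqVneq a ord0; first by exists (Ordinal lt1).
  by exists ord0.
have [a NLa|NL0] := pickP NL; last first.
  have [b ab] := neq ord0; exists ord0, b; split=> // i _ _.
  by apply: linear; rewrite NL0.
have [b /andP[ab NLb]|NL1] := pickP (fun b => (a != b) && NL b); last first.
  have [b ab] := neq a; exists a, b; split=> // i ia _.
  by apply: linear; have := NL1 i; rewrite eq_sym ia /= => ->.
exists a, b; split=> // i ia ib; apply: linear; apply/negP => NLi.
by apply: (smooth_three_nonlinear_blocksF smooth ab _ _ NLa NLb NLi); rewrite eq_sym.
Qed.

Lemma td_mon_deg1 (i : block) j : td_deg i = 1%N -> td_mon i = td_var (i := i) j.
Proof.
rewrite /td_deg /td_mon (bigD1 j) //= [\prod_(_ < _) _](bigD1 j) //= => d1.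
have [bj b0] : td_beta j = 1%N /\ (\sum_(j' | j' != j) td_beta j' = 0)%N.
  by have := td_beta_gt0 j; move: d1; case: (td_beta j) => [|[|m]] //= [].
rewrite bj expr1 big1 ?mulr1 // => j' jj'.
by move/eqP: b0; rewrite sum_nat_eq0 => /forallP/(_ j')/implyP/(_ jj')/eqP->.
Qed.

Lemma td_mon_eq_on (A : comAlgType k) (f g : {lrmorphism {mpoly k[td_n D]} -> A})
    (i : block) :
  (forall j, f (td_var (i := i) j) = g (td_var j)) ->
  f (td_mon i) = g (td_mon i).
Proof. by move=> fg; rewrite !rmorph_td_mon; apply: eq_bigr => j _; rewrite fg. Qed.

Lemma trinomial_eliminate (a b : block) : a != b ->
  (forall i, i != a -> i != b -> td_deg i = 1%N) ->
  exists d, Spec_iso (trinomial_ring D) (coord_affine_space k d).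
Proof.
move=> ab linear.
pose V := [pred x : 'I_(td_n D) | (tagnat.sig1 x == a) || (tagnat.sig1 x == b)].
have Rank_V (i : block) (j : 'I_(td_size i)) :
    (tagnat.Rank i j \in V) = (i == a) || (i == b).
  by rewrite inE /= tagnat.Rank1K.
have Vx0 : tagnat.Rank a (Ordinal (td_size_gt0 a)) \in V by rewrite Rank_V eqxx.
pose d := #|V|; pose Q := {mpoly k[d]}.
pose coord x : Q := 'X_(enum_rank_in Vx0 x).
pose restr : {lrmorphism {mpoly k[td_n D]} -> Q} :=
  mpoly_eval (fun x => if x \in V then coord x else 0).
have [y [ya yb y_rel]] :=
  @td_comb_of_pair k D Q (restr (td_mon a)) (restr (td_mon b)) a b ab.
pose G0 : {lrmorphism {mpoly k[td_n D]} -> Q} :=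
  mpoly_eval (fun x => if x \in V then coord x else y (tagnat.sig1 x)).
have G0_ab (i : block) : (i == a) || (i == b) -> G0 (td_mon i) = restr (td_mon i).
  move=> iab; apply: td_mon_eq_on => j.
  by rewrite /td_var /= !mpoly_evalX Rank_V iab.
have G0_mon i : G0 (td_mon i) = y i.
  have [->|ia] := eqVneq i a; first by rewrite ya G0_ab ?eqxx.
  have [->|ib] := eqVneq i b; first by rewrite yb G0_ab ?eqxx ?orbT.
  pose j0 := Ordinal (td_size_gt0 i).
  rewrite (td_mon_deg1 j0 (linear i ia ib)) /td_var /= mpoly_evalX.
  by rewrite Rank_V (negPf ia) (negPf ib) tagnat.Rank1K.
have [G GE] : exists G : {lrmorphism trinomial_ring D -> Q},
    forall p, G (trin_pi p) = G0 p.
  by apply: trin_lift_exists => u; rewrite rmorph_td_rel !G0_mon y_rel.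
pose F : {lrmorphism Q -> trinomial_ring D} :=
  mpoly_eval (fun u => trin_pi 'X_(enum_val u)).
have F_coord x : x \in V -> F (coord x) = trin_pi 'X_x.
  by move=> xV; rewrite /= mpoly_evalX enum_rankK_in.
have F_ab (i : block) : (i == a) || (i == b) ->
    F (restr (td_mon i)) = trin_pi (td_mon i).
  move=> iab; apply: (td_mon_eq_on (f := F \o restr) (g := @trin_pi k D)) => j.
  by rewrite /td_var /= mpoly_evalX Rank_V iab F_coord // Rank_V.
have F_y i : F (y i) = trin_pi (td_mon i).
  apply: (scalerI (td_det_neq0 ab)).
  rewrite (@td_cramer k D _ (fun i => F (y i)) a b i); last first.
    by move=> u; rewrite -linearZ -!rmorphD y_rel rmorph0.
  rewrite (@td_cramer k D _ (fun i => trin_pi (td_mon i)) a b i); last first.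
    by move=> u; rewrite -rmorph_td_rel; exact: trin_pi_rel.
  by rewrite ya yb !F_ab ?eqxx ?orbT.
exists d, F, G.
- apply: (mpoly_lrmorph_ext (f := G \o F) (g := idfun)) => u.
  rewrite /= mpoly_evalX GE /= mpoly_evalX enum_valP.
  by rewrite /coord enum_valK_in.
move=> x; have [p <-] := trin_pi_surj x; rewrite GE.
apply: (mpoly_lrmorph_ext (f := F \o G0) (g := @trin_pi k D)) => v.
rewrite /= mpoly_evalX; case: ifP => vV; first exact: F_coord.
have /norP[va vb] : ~~ ((tagnat.sig1 v == a) || (tagnat.sig1 v == b)).
  by rewrite -[_ || _]/(v \in V) vV.
rewrite [LHS]F_y (td_mon_deg1 (tagnat.sig2 v) (linear _ va vb)) /td_var.
by rewrite tagnat.sig2K.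
Qed.

End Elimination.

Theorem corollary4p4 (k : closedFieldType) (D : trinomial_data k)
  (Xsmooth : smooth_over (trinomial_ring D)) :
  exists2 d : nat, krull_dim (trinomial_ring D) d
    & Spec_iso (trinomial_ring D) (coord_affine_space k d).
Proof.
have [_ /smooth_two_blocks[a [b [ab linear]]]] := Xsmooth.
have [d [f f_bij]] := trinomial_eliminate ab linear.
exists d; last by exists f.
exact: krull_dim_iso f_bij (krull_dim_mpoly k d).
Qed.
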